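(* Let $\mathcal C$ be a small category, let $\mathcal O$ be an orbit family for $\mathcal C$ and let $p\colon\mathbb E\to\mathbb B$ be a morphism of $\mathcal C$-spaces. (1) If $p$ is $\mathcal O$-surjective, then $\mathrm{sec}_{\mathcal C}(p)\leq\mathrm{cat}_{\mathcal C}^{\mathcal O}(\mathbb B)$. (2) If $\mathrm{cat}_{\mathcal C}^{\mathcal O}(\mathbb E)=0$, then $\mathrm{cat}_{\mathcal C}^{\mathcal O}(\mathbb B)\leq\mathrm{sec}_{\mathcal C}(p)$. Consequently, if both hypotheses hold, then $\mathrm{sec}_{\mathcal C}(p)=\mathrm{cat}_{\mathcal C}^{\mathcal O}(\mathbb B)$.
   Context: All categories are small. $\mathrm{Top}$ is the category of compactly generated topological spaces; products, subspaces and mapping spaces are taken in compactly generated spaces. A $\mathcal C$-space is a functor $\mathbb X\colon\mathcal C\to\mathrm{Top}$; a morphism of $\mathcal C$-spaces ($\mathcal C$-map) is a natural transformation. Products are objectwise; a space $K$ is also regarded as a constant $\mathcal C$-space; $\mathbb I=[0,1]$. A $\mathcal C$-homotopy from $f$ to $g$ (with $f,g\colon\mathbb X\to\mathbb Y$) is a $\mathcal C$-map $H\colon\mathbb X\times\mathbb I\to\mathbb Y$ with $H_0=f$, $H_1=g$; then write $f\simeq_{\mathcal C}g$. A topological $\mathcal C$-orbit is a $\mathcal C$-space $\mathbb T$ with $\varinjlim_{\mathcal C}\mathbb T\cong *$ (colimit in $\mathrm{Top}$). An orbit family for $\mathcal C$ is a class $\mathcal O$ of topological $\mathcal C$-orbits,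 closed under isomorphism and containing every representable $\mathcal C(c,-)$, regarded as an objectwise discrete $\mathcal C$-space. $p$ is $\mathcal O$-surjective if for every $\mathbb T\in\mathcal O$ every $\mathcal C$-map $O\colon\mathbb T\to\mathbb B$ admits a $\mathcal C$-map $\widetilde O\colon\mathbb T\to\mathbb E$ with $p\circ\widetilde O=O$. An open $\mathcal C$-subspace $\mathbb U\subseteq\mathbb X$ is a family of open subspaces $\mathbb U(c)\subseteq\mathbb X(c)$ stable under the structure maps of $\mathbb X$ (with restricted structure maps); $\iota_{\mathbb U}\colon\mathbb U\hookrightarrow\mathbb X$ is the inclusion. An open cover of $\mathbb X$ is a collection $\{\mathbb U_i\}$ of open $\mathcal C$-subspaces with $\mathbb X(c)=\bigcup_i\mathbb U_i(c)$ for every object $c$. $\mathbb U$ is $\mathcal O$-categorical in $\mathbb X$ if there are $\mathbb T\in\mathcal O$ and $\mathcal C$-maps $a\colon\mathbb U\to\mathbb T$, $O\colon\mathbb T\to\mathbb X$ with $\iota_{\mathbb U}\simeq_{\mathcal C}O\circ a$. $\mathrm{cat}_{\mathcal C}^{\mathcal O}(\mathbb X)$ is the least integer $n\ge0$ such that $\mathbb X$ has an open cover $\{\mathbb U_0,\dots,\mathbb U_n\}$ by $\mathcal O$-categorical open $\mathcal C$-subspaces ($\infty$ if none exists). An open $\mathcal C$-subspace $\mathbb U\subseteq\mathbb B$ is sectional for $p$ if there is a $\mathcal C$-map $s\colon\mathbb U\to\mathbb E$ with $p\circ s\simeq_{\mathcal C}\iota_{\mathbb U}$. $\mathrm{sec}_{\mathcal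 C}(p)$ is the least integer $n\ge0$ such that $\mathbb B$ has an open cover $\{\mathbb U_0,\dots,\mathbb U_n\}$ by sectional open $\mathcal C$-subspaces ($\infty$ if none exists). *)

(* Defs.v *)
From HB Require Import structures.
From mathcomp Require Import all_boot all_order all_algebra.
From mathcomp Require Import all_classical all_reals all_analysis.
Set Implicit Arguments.
Unset Strict Implicit.
Unset Printing Implicit Defensive.

Import Order.TTheory GRing.Theory Num.Theory numFieldNormedType.Exports.

Local Open Scope classical_set_scope.

(* Compactly generated is taken without separation axiom: the space carries the
   final topology for all continuous maps from compact Hausdorff spaces. *)

Definition k_open (X : topologicalType) (A : set X) : Prop :=
  forall (K : topologicalType), compact [set: K] -> hausdorff_space K ->
  forall f : K -> X, continuous f -> open (f @^-1` A).

HB.mixin Record isCompactlyGenerated T & Topological T := {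
  k_open_open : forall A : set T, k_open A -> open A
}.

#[short(type="cgType")]
HB.structure Definition CompactlyGenerated :=
  {T of Topological T & isCompactlyGenerated T}.

(* [kify X] is the set underlying [X] with the compactly generated topology
   whose open sets are the [k_open] sets of [X]. *)
Definition kify (X : Type) : Type := X.

Section Kify.
Variable X : topologicalType.

HB.instance Definition _ := Choice.on (kify X).

Fact kify_openT : @k_open X setT.
Proof. by move=> K _ _ f _; rewrite preimage_setT; exact: openT. Qed.

Fact kify_openI : setI_closed (@k_open X).
Proof.
move=> A B oA oB K cK hK f cf.
by rewrite preimage_setI; apply: openI; [exact: oA|exact: oB].
Qed.

Fact kify_open_bigU (I : Type) (F : I -> set X) :
  (forall i, k_open (F i)) -> k_open (\bigcup_i F i).
Proof.
move=> oF K cK hK f cf; rewrite preimage_bigcup.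
by apply: bigcup_open => i _; exact: oF.
Qed.

HB.instance Definition _ :=
  isOpenTopological.Build (kify X) kify_openT kify_openI kify_open_bigU.

Lemma kify_openE (A : set X) : @open (kify X) A = k_open A.
Proof. by []. Qed.

Lemma kify_continuous (K : topologicalType) (f : K -> X) :
  compact [set: K] -> hausdorff_space K -> continuous f ->
  continuous (f : K -> kify X).
Proof.
by move=> cK hK cf; apply/continuousP => A; rewrite kify_openE; exact.
Qed.

Fact kify_cg (A : set (kify X)) : k_open A -> open A.
Proof.
move=> oA; rewrite kify_openE => K cK hK f cf.
exact: (oA K cK hK _ (kify_continuous cK hK cf)).
Qed.

HB.instance Definition _ := isCompactlyGenerated.Build (kify X) kify_cg.

End Kify.

Lemma kify_map_continuous (X Y : topologicalType) (f : X -> Y) :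
  continuous f -> continuous (f : kify X -> kify Y).
Proof.
move=> cf; apply/continuousP => A; rewrite !kify_openE => oA K cK hK g cg.
apply: (oA K cK hK (f \o g)) => x.
by apply: continuous_comp; [exact: cg|exact: cf].
Qed.

Lemma kify_out_continuous (X Y : topologicalType) (f : X -> Y) :
  continuous f -> continuous (f : kify X -> Y).
Proof.
move=> /continuousP cf; apply/continuousP => A /cf oA.
by rewrite kify_openE => K _ _ g /continuousP; exact.
Qed.

Section Discrete.
Variable T : choiceType.

Fact discrete_cg (A : set (discrete_topology T)) : k_open A -> open A.
Proof. by move=> _; exact: discrete_open. Qed.

HB.instance Definition _ :=
  isCompactlyGenerated.Build (discrete_topology T) discrete_cg.

End Discrete.

Definition cg_point : cgType := [the cgType of discrete_topology unit].

Definition homeomorphic (X Y : cgType) : Prop :=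
  exists (f : continuousType X Y) (g : continuousType Y X),
    cancel f g /\ cancel g f.

(* Products and subspaces below are [kify]ed because these operations are taken
   in compactly generated spaces; for [0,1] and for open subspaces this does
   not change the subspace topology. *)
Definition unit_interval (R : realType) : cgType :=
  [the cgType of kify (set_type (`[0%R, 1%R]%classic : set R))].

Fact zero_in_unit_interval (R : realType) :
  (0%R : R) \in (`[0%R, 1%R]%classic : set R).
Proof. by rewrite inE /= in_itv /= lexx ler01. Qed.

Fact one_in_unit_interval (R : realType) :
  (1%R : R) \in (`[0%R, 1%R]%classic : set R).
Proof. by rewrite inE /= in_itv /= lexx ler01. Qed.

Definition I0 (R : realType) : unit_interval R :=
  exist _ 0%R (zero_in_unit_interval R).

Definition I1 (R : realType) : unit_interval R :=
  exist _ 1%R (one_in_unit_interval R).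

Record smallCategory := SmallCategory {
  ob :> Type;
  mor : ob -> ob -> Type;
  mor_id : forall c, mor c c;
  mor_comp : forall b c d, mor c d -> mor b c -> mor b d;
  mor_comp1 : forall c d (f : mor c d), mor_comp f (mor_id c) = f;
  mor_1comp : forall c d (f : mor c d), mor_comp (mor_id d) f = f;
  mor_compA : forall a b c d (h : mor c d) (g : mor b c) (f : mor a b),
    mor_comp h (mor_comp g f) = mor_comp (mor_comp h g) f
}.

Section CSpaces.
Variable C : smallCategory.

Record cspace := CSpace {
  cs_ob :> C -> cgType;
  cs_map : forall c d, mor c d -> continuousType (cs_ob c) (cs_ob d);
  cs_map1 : forall c (x : cs_ob c), cs_map (mor_id c) x = x;
  cs_mapM : forall b c d (g : mor c d) (f : mor b c) (x : cs_ob b),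
    cs_map (mor_comp g f) x = cs_map g (cs_map f x)
}.

Record cmap (X Y : cspace) := CMap {
  cm_fun :> forall c, continuousType (X c) (Y c);
  cm_nat : forall c d (f : mor c d) (x : X c),
    cm_fun d (cs_map X f x) = cs_map Y f (cm_fun c x)
}.

Lemma cmapP (X Y : cspace) (f g : cmap X Y) :
  (forall c x, f c x = g c x) -> f = g.
Proof.
case: f g => [f nf] [g ng] /= fg.
have e : f = g.
  by apply: functional_extensionality_dep => c; apply/continuousEP; exact: fg.
by case: _ / e ng => ng; congr CMap; exact: Prop_irrelevance.
Qed.

Definition cidm (X : cspace) : cmap X X :=
  @CMap X X (fun c => [the continuousType _ _ of @idfun (X c)])
    (fun c d f x => erefl).

Fact ccomp_nat (X Y Z : cspace) (g : cmap Y Z) (f : cmap X Y)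
    c d (h : mor c d) (x : X c) :
  (g d \o f d) (cs_map X h x) = cs_map Z h ((g c \o f c) x).
Proof. by rewrite /= !cm_nat. Qed.

Definition ccomp (X Y Z : cspace) (g : cmap Y Z) (f : cmap X Y) : cmap X Z :=
  @CMap X Z (fun c => [the continuousType _ _ of g c \o f c]) (ccomp_nat g f).

Definition cisomorphic (X Y : cspace) : Prop :=
  exists (f : cmap X Y) (g : cmap Y X),
    ccomp g f = cidm X /\ ccomp f g = cidm Y.

Definition ccst (K : cgType) : cspace :=
  @CSpace (fun=> K) (fun _ _ _ => [the continuousType _ _ of @idfun K])
    (fun _ _ => erefl) (fun _ _ _ _ _ _ => erefl).

Section Product.
Variables X Y : cspace.

Definition cprod_fun c d (f : mor c d) :
    kify (X c * Y c)%type -> kify (X d * Y d)%type :=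
  fun z => (cs_map X f z.1, cs_map Y f z.2).

Fact cprod_fun_continuous c d (f : mor c d) : continuous (cprod_fun f).
Proof.
apply: kify_map_continuous => z; apply: cvg_pair => /=.
  apply: (continuous_comp (f := fst) (g := cs_map X f)); first exact: cvg_fst.
  exact: cts_fun.
apply: (continuous_comp (f := snd) (g := cs_map Y f)); first exact: cvg_snd.
exact: cts_fun.
Qed.

Definition cprod_map c d (f : mor c d) :
    continuousType (kify (X c * Y c)%type) (kify (X d * Y d)%type) :=
  [the continuousType _ _ of mkcts (@cprod_fun_continuous c d f)].

Fact cprod_map1 c (z : kify (X c * Y c)%type) :
  cprod_map (mor_id c) z = z.
Proof. by case: z => x y; rewrite /= /mkcts /cprod_fun /= !cs_map1. Qed.

Fact cprod_mapM b c d (g : mor c d) (f : mor b c)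
    (z : kify (X b * Y b)%type) :
  cprod_map (mor_comp g f) z = cprod_map g (cprod_map f z).
Proof. by rewrite /= /mkcts /cprod_fun /= !cs_mapM. Qed.

Definition cprod : cspace :=
  @CSpace (fun c => [the cgType of kify (X c * Y c)%type]) cprod_map
    cprod_map1 cprod_mapM.

End Product.

Definition chomotopic (R : realType) (X Y : cspace) (f g : cmap X Y) : Prop :=
  exists H : cmap (cprod X (ccst (unit_interval R))) Y,
    (forall c (x : X c), H c (x, I0 R) = f c x) /\
    (forall c (x : X c), H c (x, I1 R) = g c x).

(* A cocone under [X] with vertex [L] is a [cmap] from [X] to the constant
   [cspace] at [L]. *)
Definition is_colimit (X : cspace) (L : cgType) (lam : cmap X (ccst L)) :
    Prop :=
  forall (Z : cgType) (mu : cmap X (ccst Z)),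
    exists! h : continuousType L Z, forall c (x : X c), h (lam c x) = mu c x.

Definition is_orbit (T : cspace) : Prop :=
  exists (L : cgType) (lam : cmap T (ccst L)),
    is_colimit lam /\ homeomorphic L cg_point.

Section Representable.
Variable c : C.

(* [{classic _}] equips the hom-set with the choice structure that
   topological types carry in the library. *)
Definition rep_ob (d : C) : cgType :=
  [the cgType of discrete_topology {classic mor c d}].

Definition rep_fun d e (f : mor d e) : rep_ob d -> rep_ob e :=
  fun u : mor c d => mor_comp f u.

Fact rep_fun_continuous d e (f : mor d e) : continuous (rep_fun f).
Proof. by apply/continuousP => A _; exact: discrete_open. Qed.

Definition rep_map d e (f : mor d e) :
    continuousType (rep_ob d) (rep_ob e) :=
  [the continuousType _ _ of mkcts (@rep_fun_continuous d e f)].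

Fact rep_map1 d (u : rep_ob d) : rep_map (mor_id d) u = u.
Proof. exact: mor_1comp. Qed.

Fact rep_mapM b d e (g : mor d e) (f : mor b d) (u : rep_ob b) :
  rep_map (mor_comp g f) u = rep_map g (rep_map f u).
Proof. by symmetry; exact: mor_compA. Qed.

Definition representable : cspace :=
  @CSpace rep_ob rep_map rep_map1 rep_mapM.

End Representable.

Record orbitFamily := OrbitFamily {
  orbits :> cspace -> Prop;
  orb_orbit : forall T, orbits T -> is_orbit T;
  orb_iso : forall T T', cisomorphic T T' -> orbits T -> orbits T';
  orb_rep : forall c, orbits (representable c)
}.

Definition orbit_surjective (O : orbitFamily) (E B : cspace) (p : cmap E B) :
    Prop :=
  forall T, O T -> forall o : cmap T B, exists o' : cmap T E, ccomp p o' = o.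

Record openSub (X : cspace) := OpenSub {
  os_set :> forall c, set (X c);
  os_open : forall c, open (@os_set c);
  os_stable : forall c d (f : mor c d) (x : X c),
    os_set x -> os_set (cs_map X f x)
}.

Arguments os_set {X} _ c _.

Section OpenSubspace.
Variables (X : cspace) (U : openSub X).

Definition os_fun c d (f : mor c d) :
    kify (set_type (U c)) -> kify (set_type (U d)) :=
  fun x => exist _ (cs_map X f (set_val x))
    (mem_set (os_stable f (set_valP x))).

Fact os_fun_continuous c d (f : mor c d) : continuous (os_fun f).
Proof.
apply: kify_map_continuous; apply/continuousP => A [B oB <-].
have -> : os_fun f @^-1` (set_val @^-1` B) =
    (cs_map X f \o set_val) @^-1` B by [].
move: B oB; apply/continuousP => x; apply: continuous_comp.
  exact: initial_continuous.
exact: cts_fun.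
Qed.

Definition os_map c d (f : mor c d) :
    continuousType (kify (set_type (U c))) (kify (set_type (U d))) :=
  [the continuousType _ _ of mkcts (@os_fun_continuous c d f)].

Fact os_map1 c (x : kify (set_type (U c))) : os_map (mor_id c) x = x.
Proof. by apply: val_inj; rewrite /= cs_map1. Qed.

Fact os_mapM b c d (g : mor c d) (f : mor b c) (x : kify (set_type (U b))) :
  os_map (mor_comp g f) x = os_map g (os_map f x).
Proof. by apply: val_inj; rewrite /= cs_mapM. Qed.

Definition os_space : cspace :=
  @CSpace (fun c => [the cgType of kify (set_type (U c))])
    os_map os_map1 os_mapM.

Definition os_incl_fun c : os_space c -> X c := fun x => set_val x.

Fact os_incl_continuous c : continuous (@os_incl_fun c).
Proof. by apply: kify_out_continuous; exact: initial_continuous. Qed.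

Definition os_incl : cmap os_space X :=
  @CMap os_space X
    (fun c => [the continuousType _ _ of mkcts (@os_incl_continuous c)])
    (fun c d f x => erefl).

End OpenSubspace.

Definition csub_cover (X : cspace) (n : nat) (U : 'I_n -> openSub X) : Prop :=
  forall c, \bigcup_i U i c = [set: X c].

Definition coverable (X : cspace) (P : openSub X -> Prop) (n : nat) : Prop :=
  exists U : 'I_n.+1 -> openSub X, csub_cover U /\ forall i, P (U i).

End CSpaces.

Definition least_or_infty (R : realType) (P : nat -> Prop) : \bar R :=
  match pselect (exists n, `[< P n >]) with
  | left h => ((ex_minn h)%:R)%:E
  | right _ => +oo%E
  end.

Definition categorical (R : realType) (C : smallCategory) (O : orbitFamily C)
    (X : cspace C) (U : openSub X) : Prop :=
  exists T, O T /\ exists (a : cmap (os_space U) T) (o : cmap T X),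
    chomotopic R (os_incl U) (ccomp o a).

Definition catC (R : realType) (C : smallCategory) (O : orbitFamily C)
    (X : cspace C) : \bar R :=
  least_or_infty R (coverable (categorical R O (X := X))).

Definition sectional (R : realType) (C : smallCategory) (E B : cspace C)
    (p : cmap E B) (U : openSub B) : Prop :=
  exists s : cmap (os_space U) E, chomotopic R (ccomp p s) (os_incl U).

Definition secC (R : realType) (C : smallCategory) (E B : cspace C)
    (p : cmap E B) : \bar R :=
  least_or_infty R (coverable (sectional R p)).

(* Main.v *)
Require Import Defs.
From mathcomp Require Import all_boot all_order all_algebra.
From mathcomp Require Import all_classical all_reals all_analysis.
From mathcomp Require Import lra.

Set Implicit Arguments.
Unset Strict Implicit.
Unset Printing Implicit Defensive.

Import Order.TTheory GRing.Theory Num.Theory numFieldNormedType.Exports.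

Local Open Scope classical_set_scope.
Local Open Scope ring_scope.

(** Both inequalities compare, for one and the same open set [U] of [B], the
    conditions of being categorical and of being sectional; a cover that
    witnesses one invariant then witnesses the other.

    If the inclusion of [U] is homotopic to [b \o a] with [a : U -> T],
    [b : T -> B] and [T] an orbit of the family, then orbit surjectivity lifts
    [b] to [b' : T -> E], and [b' \o a] is a homotopy section over [U]
    ([categorical_sectional]).

    If [E] has category 0, then a single open set covers [E], so it is all of
    [E], and the identity of [E] is homotopic to some [b \o a] with
    [a : E -> T] and [b : T -> E] ([cat0_factor]). For a homotopy section [s]
    over [U], the inclusion of [U] is homotopic to [p \o s], hence to
    [p \o b \o a \o s], which factors through [T]
    ([sectional_categorical]).

    The substance is therefore that homotopy of natural maps is symmetric,
    transitive and compatible with composition on both sides. Transitivity is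
    the delicate point, as the cylinder carries the compactly generated product
    topology. The two homotopies are run at double speed, each reparametrized
    over the whole interval, so that both are already continuous on the whole
    cylinder; they are then pasted along the closed halves of that same space
    ([cmap_paste]), so compact test spaces never have to be cut in two. *)

(** * Products and pasting of natural maps *)

Section CMaps.
Variable C : smallCategory.
Implicit Types X Y Z : cspace C.

Definition ccst_mor (K L : cgType) (phi : continuousType K L) :
    cmap (ccst C K) (ccst C L) :=
  @CMap C (ccst C K) (ccst C L) (fun=> phi) (fun _ _ _ _ => erefl).

Section ProductMap.
Variables (X X' Y Y' : cspace C) (f : cmap X X') (g : cmap Y Y').

Definition cprod_mor_fun c : kify (X c * Y c)%type -> kify (X' c * Y' c)%type :=
  fun z => (f c z.1, g c z.2).

Fact cprod_mor_continuous c : continuous (@cprod_mor_fun c).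
Proof.
apply: kify_map_continuous => z; apply: cvg_pair => /=.
  apply: (continuous_comp (f := fst) (g := f c)); first exact: cvg_fst.
  exact: cts_fun.
apply: (continuous_comp (f := snd) (g := g c)); first exact: cvg_snd.
exact: cts_fun.
Qed.

Fact cprod_mor_nat c d (h : mor c d) (z : cprod X Y c) :
  cprod_mor_fun (cs_map (cprod X Y) h z) =
  cs_map (cprod X' Y') h (cprod_mor_fun z).
Proof. by congr pair; exact: cm_nat. Qed.

Definition cprod_mor : cmap (cprod X Y) (cprod X' Y') :=
  @CMap C (cprod X Y) (cprod X' Y')
    (fun c => [the continuousType _ _ of mkcts (@cprod_mor_continuous c)])
    cprod_mor_nat.

End ProductMap.

(** The pasting lemma, carried out objectwise. Stability of both closed families
    makes the pasted map natural: the structure maps never move a point out of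
    the region where it was defined. *)
Lemma cmap_paste X Y (f g : cmap X Y) (A B : forall c, set (X c)) :
  (forall c, closed (A c)) -> (forall c, closed (B c)) ->
  (forall c d (h : mor c d) x, A c x -> A d (cs_map X h x)) ->
  (forall c d (h : mor c d) x, B c x -> B d (cs_map X h x)) ->
  (forall c x, A c x \/ B c x) ->
  (forall c x, A c x -> B c x -> f c x = g c x) ->
  exists k : cmap X Y, (forall c x, A c x -> k c x = f c x) /\
                       (forall c x, B c x -> k c x = g c x).
Proof.
move=> cA cB sA sB AB fg.
pose k c x := if x \in A c then f c x else g c x.
have kA c x : A c x -> k c x = f c x by move=> Ax; rewrite /k mem_set.
have kB c x : B c x -> k c x = g c x.
  by move=> Bx; rewrite /k; case: ifPn => // /set_mem Ax; exact: fg.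
have ck c : continuous (k c).
  apply/continuous_subspace_setT.
  have -> : [set: X c] = A c `|` B c.
    by apply/seteqP; split => // x _; exact: AB.
  apply: withinU_continuous => //.
    apply: (@subspace_eq_continuous _ _ _ (f c)).
      by move=> x /set_mem Ax; apply/esym/kA.
    by apply: continuous_subspaceT; exact: cts_fun.
  apply: (@subspace_eq_continuous _ _ _ (g c)).
    by move=> x /set_mem Bx; apply/esym/kB.
  by apply: continuous_subspaceT; exact: cts_fun.
have nk c d (h : mor c d) x : k d (cs_map X h x) = cs_map Y h (k c x).
  have [Ax|Bx] := AB c x.
    by rewrite (kA _ _ Ax) (kA _ _ (sA _ _ h _ Ax)) cm_nat.
  by rewrite (kB _ _ Bx) (kB _ _ (sB _ _ h _ Bx)) cm_nat.
by exists (@CMap C X Y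
  (fun c => [the continuousType _ _ of mkcts (ck c)]) nk).
Qed.

End CMaps.

(** * Homotopy is an equivalence relation compatible with composition *)

Section Homotopy.
Variables (R : realType) (C : smallCategory).
Implicit Types X Y Z : cspace C.

Local Notation I := (unit_interval R).

(** Continuity is checked for the subspace topology on both sides and passes to
    the compactly generated topologies by functoriality of [kify]. *)
Lemma unit_interval_map (f : R -> R) : continuous f ->
  (forall t, 0 <= t <= 1 -> 0 <= f t <= 1) ->
  exists phi : continuousType I I, forall t : I, set_val (phi t) = f (set_val t).
Proof.
move=> cf f01.
have fI (t : I) : f (set_val t) \in (`[0%R, 1%R]%classic : set R).
  by rewrite inE /= in_itv /=; apply: f01; have := set_valP t; rewrite /= in_itv.
pose phi (t : I) : I := exist _ (f (set_val t)) (fI t).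
have cphi : continuous phi.
  apply: kify_map_continuous; apply/continuousP => A [B oB <-].
  have -> : phi @^-1` (set_val @^-1` B) = (f \o set_val) @^-1` B by [].
  move: B oB; apply/continuousP => x; apply: continuous_comp.
    exact: initial_continuous.
  exact: cf.
by exists [the continuousType _ _ of mkcts cphi].
Qed.

Lemma time_continuous (X : cspace C) c :
  continuous (fun z : cprod X (ccst C I) c => set_val z.2 : R).
Proof.
apply: (kify_out_continuous (X := (X c * I)%type)) => z.
apply: (continuous_comp (f := snd) (g := (fun t : I => set_val t : R))).
  exact: cvg_snd.
apply: kify_out_continuous; exact: initial_continuous.
Qed.

Lemma reparametrize X Y (phi : continuousType I I)
    (H : cmap (cprod X (ccst C I)) Y) :
  exists K : cmap (cprod X (ccst C I)) Y, forall c x t, K c (x, t) = H c (x, phi t).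
Proof. by exists (ccomp H (cprod_mor (cidm X) (ccst_mor C phi))). Qed.

Lemma chomotopic_sym X Y (f g : cmap X Y) : chomotopic R f g -> chomotopic R g f.
Proof.
move=> [H [H0 H1]].
have [||phi phiE] := @unit_interval_map (fun t => 1 - t).
- by move=> t; apply: cvgB; [exact: cvg_cst|exact: cvg_id].
- by move=> t; lra.
have [K KE] := reparametrize phi H.
have p0 : phi (I0 R) = I1 R by apply: val_inj; rewrite [LHS]phiE /= subr0.
have p1 : phi (I1 R) = I0 R by apply: val_inj; rewrite [LHS]phiE /= subrr.
by exists K; split => c x; rewrite KE ?p0 ?p1.
Qed.

(** The reparametrizations [min (1, 2t)] and [max (0, 2t - 1)] stay constant on
    the half of the interval where the corresponding homotopy is idle; at time
    1/2 both homotopies are at the common map [g]. *)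
Lemma chomotopic_trans X Y (f g h : cmap X Y) :
  chomotopic R f g -> chomotopic R g h -> chomotopic R f h.
Proof.
move=> [H [H0 H1]] [K [K0 K1]].
have [||phi phiE] := @unit_interval_map (fun t => Num.min 1 (2 * t)).
- move=> t; apply: (@continuous_min R R (fun=> 1) (fun t => 2 * t)).
    exact: cvg_cst.
  by apply: cvgM; [exact: cvg_cst|exact: cvg_id].
- by move=> t; rewrite minEle; case: ifPn; lra.
have [||psi psiE] := @unit_interval_map (fun t => Num.max 0 (2 * t - 1)).
- move=> t; apply: (@continuous_max R R (fun=> 0) (fun t => 2 * t - 1)).
    exact: cvg_cst.
  apply: cvgB; last exact: cvg_cst.
  by apply: cvgM; [exact: cvg_cst|exact: cvg_id].
- by move=> t; rewrite maxEle; case: ifPn; lra.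
have [H' H'E] := reparametrize phi H.
have [K' K'E] := reparametrize psi K.
have phi_low (t : I) : set_val t = 0 :> R -> phi t = I0 R.
  by move=> t0; apply: val_inj; rewrite [LHS]phiE t0 /= mulr0 min_r.
have psi_high (t : I) : set_val t = 1 :> R -> psi t = I1 R.
  move=> t1; apply: val_inj; rewrite [LHS]psiE t1 /= maxEle.
  by case: ifPn; lra.
have [||||||L [LH LK]] := @cmap_paste C _ _ H' K'
  (fun c => [set z : cprod X (ccst C I) c | (set_val z.2 : R) <= 2^-1])
  (fun c => [set z : cprod X (ccst C I) c | 2^-1 <= (set_val z.2 : R)]).
- move=> c; have /continuous_closedP cl := @time_continuous X c.
  exact: (cl _ (@closed_le R _)).
- move=> c; have /continuous_closedP cl := @time_continuous X c.
  exact: (cl _ (@closed_ge R _)).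
- by [].
- by [].
- by move=> c z; apply/orP; exact: le_total.
- move=> c [x t] /= tl tg.
  have te : set_val t = 2^-1 :> R by apply/eqP; rewrite eq_le tl tg.
  have -> : H' c (x, t) = g c x.
    rewrite H'E (_ : phi t = I1 R) ?H1 //.
    by apply: val_inj; rewrite [LHS]phiE te divff // minxx.
  rewrite K'E (_ : psi t = I0 R) ?K0 //.
  by apply: val_inj; rewrite [LHS]psiE te divff // subrr maxxx.
exists L; split => c x.
  by rewrite LH ?H'E ?phi_low ?H0 //; suff : 0 <= 2^-1 :> R by []; lra.
by rewrite LK ?K'E ?psi_high ?K1 //; suff : 2^-1 <= 1 :> R by []; lra.
Qed.

Lemma chomotopic_compl X Y Z (k : cmap Y Z) (f g : cmap X Y) :
  chomotopic R f g -> chomotopic R (ccomp k f) (ccomp k g).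
Proof.
move=> [H [H0 H1]]; exists (ccomp k H).
by split => c x; rewrite /= ?H0 ?H1.
Qed.

Lemma chomotopic_compr X Y Z (f g : cmap Y Z) (k : cmap X Y) :
  chomotopic R f g -> chomotopic R (ccomp f k) (ccomp g k).
Proof.
move=> [H [H0 H1]]; exists (ccomp H (cprod_mor k (cidm (ccst C I)))).
by split => c x; rewrite /= -?H0 -?H1.
Qed.

End Homotopy.

(** * Covers by one open set *)

(** [kify] is the coreflection onto compactly generated spaces: a probe of [X]
    by a compact Hausdorff space becomes, after [f], a probe of [Y]. *)
Lemma cg_continuous (X : cgType) (Y : topologicalType) (f : X -> Y) :
  continuous f -> continuous (f : X -> kify Y).
Proof.
move=> cf; apply/continuousP => A; rewrite kify_openE => oA.
apply: k_open_open => K cK hK g cg.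
apply: (oA K cK hK (f \o g)) => x.
by apply: continuous_comp; [exact: cg|exact: cf].
Qed.

(** An open subspace is a [kify]ed subset type, so even the whole space is not
    literally its own open subspace; the objects of [X] being compactly
    generated, the identity still lands continuously in it. *)
Lemma os_full_section (C : smallCategory) (X : cspace C) (U : openSub X) :
  (forall c, U c = [set: X c]) ->
  exists j : cmap X (os_space U), ccomp (os_incl U) j = cidm X.
Proof.
move=> UT.
have inU c (x : X c) : x \in U c by rewrite UT in_setT.
pose j c (x : X c) : os_space U c := exist _ x (inU c x).
have cj c : continuous (j c).
  apply: cg_continuous; apply/continuousP => A [B oB <-].
  by have -> : j c @^-1` (set_val @^-1` B) = B by [].
have nj c d (f : mor c d) (x : X c) :
    j d (cs_map X f x) = cs_map (os_space U) f (j c x).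
  exact: val_inj.
exists (@CMap C X (os_space U)
  (fun c => [the continuousType _ _ of mkcts (cj c)]) nj).
exact: cmapP.
Qed.

(** * Comparison of the two invariants *)

Lemma least_or_infty_le (R : realType) (P Q : nat -> Prop) :
  (forall n, P n -> Q n) -> (least_or_infty R Q <= least_or_infty R P)%E.
Proof.
move=> PQ; rewrite /least_or_infty.
case: (pselect (exists n, `[< P n >])) => [hP|_]; last by rewrite leey.
case: pselect => [hQ|[]]; last first.
  by have [n /asboolP/PQ Qn] := hP; exists n; exact/asboolP.
rewrite lee_fin ler_nat; case: ex_minnP => m _; apply.
by case: ex_minnP => n /asboolP/PQ Qn _; exact/asboolP.
Qed.

Lemma least_or_infty_eq0 (R : realType) (P : nat -> Prop) :
  least_or_infty R P = 0%E -> P 0%N.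
Proof.
rewrite /least_or_infty; case: pselect => // h [] /eqP.
by rewrite pnatr_eq0; case: ex_minnP => m /asboolP Pm _ /eqP <-.
Qed.

Lemma coverable_mono (C : smallCategory) (X : cspace C)
    (P Q : openSub X -> Prop) n :
  (forall U, P U -> Q U) -> coverable P n -> coverable Q n.
Proof. by move=> PQ [U [cU PU]]; exists U; split => // i; exact: PQ. Qed.

(** Lifting [b : T -> B] through [p] lifts the whole composite [b \o a], to which
    the inclusion of [U] is homotopic. *)
Lemma categorical_sectional (R : realType) (C : smallCategory)
    (O : orbitFamily C) (E B : cspace C) (p : cmap E B) (U : openSub B) :
  orbit_surjective O p -> categorical R O U -> sectional R p U.
Proof.
move=> surj_p [T [OT [a [b iba]]]].
have [b' pb'] := surj_p T OT b.
exists (ccomp b' a); apply: chomotopic_sym.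
have -> : ccomp p (ccomp b' a) = ccomp b a by rewrite -pb'; exact: cmapP.
exact: iba.
Qed.

(** The only member of the cover is all of [X], so composing its homotopy with
    the section of its inclusion puts the identity in place of the inclusion. *)
Lemma cat0_factor (R : realType) (C : smallCategory) (O : orbitFamily C)
    (X : cspace C) :
  catC R O X = 0%E ->
  exists T, O T /\ exists (a : cmap X T) (b : cmap T X),
    chomotopic R (cidm X) (ccomp b a).
Proof.
move=> /least_or_infty_eq0[U [cU catU]].
have UT c : U ord0 c = [set: X c].
  rewrite -(cU c); apply/seteqP; split => [x Ux|x [i _]]; first by exists ord0.
  by rewrite ord1.
have [T [OT [a [b iba]]]] := catU ord0.
have [j ij] := os_full_section UT.
exists T; split => //; exists (ccomp a j), b.
have -> : ccomp b (ccomp a j) = ccomp (ccomp b a) j by exact: cmapP.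
by rewrite -ij; exact: chomotopic_compr.
Qed.

(** Inserting the factorization of the identity of [E] through an orbit between
    [s] and [p] makes [p \o s], hence the inclusion of [U], factor through it. *)
Lemma sectional_categorical (R : realType) (C : smallCategory)
    (O : orbitFamily C) (E B : cspace C) (p : cmap E B) (U : openSub B) :
  catC R O E = 0%E -> sectional R p U -> categorical R O U.
Proof.
move=> /cat0_factor[T [OT [a [b iba]]]] [s ps].
exists T; split => //; exists (ccomp a s), (ccomp p b).
apply: chomotopic_trans (chomotopic_sym ps) _.
have -> : ccomp (ccomp p b) (ccomp a s) = ccomp p (ccomp (ccomp b a) s).
  exact: cmapP.
apply: chomotopic_compl.
have {1}-> : s = ccomp (cidm E) s by exact: cmapP.
exact: chomotopic_compr.
Qed.

Theorem theorem4p4 (R : realType) (C : smallCategory) (O : orbitFamily C)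
    (E B : cspace C) (p : cmap E B) :
  (orbit_surjective O p -> (secC R p <= catC R O B)%E) /\
  (catC R O E = 0%E -> (catC R O B <= secC R p)%E) /\
  (orbit_surjective O p -> catC R O E = 0%E -> secC R p = catC R O B).
Proof.
have sec_le_cat : orbit_surjective O p -> (secC R p <= catC R O B)%E.
  move=> surj_p; apply: least_or_infty_le => n; apply: coverable_mono => U.
  exact: categorical_sectional.
have cat_le_sec : catC R O E = 0%E -> (catC R O B <= secC R p)%E.
  move=> cat0; apply: least_or_infty_le => n; apply: coverable_mono => U.
  exact: sectional_categorical.
split=> //; split=> // surj_p cat0; apply/eqP.
by rewrite eq_le sec_le_cat ?cat_le_sec.
Qed.
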